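(* Let $(\mathcal X,d)$ be a metric space, $S=(X_1,\dots,X_n)$ a fixed sample in $\mathcal X$, and $H\subset C(\mathcal X)$. Let $F\subset C(\mathcal X,\mathcal X)$ be totally bounded in $d_S$ and assume $\mathrm{id}\in F$. For $f\in F$ set $$Z_f(\sigma):=\sup_{h\in H}\frac1n\sum_{i=1}^n\sigma_i h(f(X_i)),$$ where $\sigma_1,\dots,\sigma_n$ are i.i.d. Rademacher variables. Suppose there exist constants $L>0$ and $A_H>0$ such that for every $f,g\in F$ and $t>0$, $$\mathbb P_\sigma\big(|Z_f-Z_g|>t\big)\le 2\exp\Big(-\frac{nt^2}{2A_H^2L^2d_S(f,g)^2}\Big),$$ where, if $d_S(f,g)=0$, the right-hand side is interpreted as $0$ (so that $Z_f=Z_g$ almost surely is required). Then $$\hat{\mathfrak R}_S(H\circ F)\le\hat{\mathfrak R}_S(H)+\frac{12A_HL}{\sqrt n}\int_0^{\mathrm{diam}_S(F)}\sqrt{\log N(F,d_S,\varepsilon)}\,d\varepsilon .$$ In particular, for $F_0\subset C(\mathcal X,\mathcal X)$ and $k\ge0$, the same bound applies to $\mathcal H_k=H\circ B(k,F_0)$ by taking $F=B(k,F_0)$ (when this $F$ satisfies the hypotheses).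
   Context: $d_S(f,g):=\big(\frac1n\sum_{i=1}^n d(f(X_i),g(X_i))^2\big)^{1/2}$ for maps $f,g:\mathcal X\to\mathcal X$ (a pseudo-metric), and $\mathrm{diam}_S(F):=\sup_{f,g\in F}d_S(f,g)$. $H\circ F=\{h\circ f:h\in H,f\in F\}$. $B(k,F_0)$ is the set of all compositions $f_m\circ\cdots\circ f_1$ with $0\le m\le k$, $f_i\in F_0$ (including the identity). $N(A,\rho,\varepsilon)$ is the $\varepsilon$-covering number: the least number of $\rho$-balls of radius $\varepsilon$ (centers in the ambient space, here $C(\mathcal X,\mathcal X)$) covering $A$. $\hat{\mathfrak R}_S(G):=\mathbb E_\sigma\big[\sup_{g\in G}\frac1n\sum_{i=1}^n\sigma_i g(X_i)\big]$. *)

(* Defs.v *)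
From HB Require Import structures.
From mathcomp Require Import all_boot all_order all_algebra.
From mathcomp Require Import all_classical all_reals all_analysis.

Set Implicit Arguments.
Unset Strict Implicit.
Unset Printing Implicit Defensive.

Import Order.TTheory GRing.Theory Num.Theory.
Import numFieldNormedType.Exports.

Local Open Scope classical_set_scope.
Local Open Scope ring_scope.

(* A realization of n i.i.d. Rademacher variables; [true] encodes the sign -1
   and [false] the sign +1. *)
Definition signs (n : nat) := {ffun 'I_n -> bool}.

Definition sgn (R : realType) (n : nat) (s : signs n) (i : 'I_n) : R :=
  (-1) ^+ s i.

(* Joint law of (sigma_1, ..., sigma_n): by independence the probability of a
   sign vector is the product of the marginals P(sigma_i = +1) =
   P(sigma_i = -1) = 1/2. *)
Definition rademacher_mass (R : realType) (n : nat) (s : signs n) : R :=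
  \prod_(i < n) 2^-1.

Definition Psigma (R : realType) (n : nat) (A : pred (signs n)) : R :=
  \sum_(s : signs n | A s) rademacher_mass R s.

Definition Esigma (R : realType) (n : nat) (phi : signs n -> \bar R) : \bar R :=
  (\sum_(s : signs n) (rademacher_mass R s)%:E * phi s)%E.

Definition sign_average (R : realType) (X : Type) (n : nat) (S : 'I_n -> X)
    (s : signs n) (g : X -> R) : R :=
  n%:R^-1 * \sum_(i < n) sgn R s i * g (S i).

(* Suprema are taken in \bar R, so that no boundedness of the function class is
   presupposed. *)
Definition rademacher_complexity (R : realType) (X : Type) (n : nat)
    (S : 'I_n -> X) (G : set (X -> R)) : \bar R :=
  Esigma (fun s => ereal_sup [set (sign_average S s g)%:E | g in G]).

Definition Zsup (R : realType) (X : Type) (n : nat) (S : 'I_n -> X)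
    (H : set (X -> R)) (f : X -> X) (s : signs n) : \bar R :=
  ereal_sup [set (sign_average S s (h \o f))%:E | h in H].

Definition comp_class (X Y Z : Type) (H : set (Y -> Z)) (F : set (X -> Y)) :
    set (X -> Z) :=
  [set h \o f | h in H & f in F].

Fixpoint comp_words (X : Type) (F0 : set (X -> X)) (m : nat) : set (X -> X) :=
  if m is m'.+1 then comp_class F0 (comp_words F0 m') else [set idfun].

(* All f_m \o ... \o f_1 with 0 <= m <= k and f_i in F0; the word of length
   m = 0 is the identity. *)
Definition comp_ball (X : Type) (k : nat) (F0 : set (X -> X)) :
    set (X -> X) :=
  [set g | exists2 m, (m <= k)%N & comp_words F0 m g].

Definition dS (R : realType) (X : metricType R) (n : nat) (S : 'I_n -> X)
    (f g : X -> X) : R :=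
  Num.sqrt (n%:R^-1 * \sum_(i < n) mdist (f (S i)) (g (S i)) ^+ 2).

Definition diam (R : realType) (T : Type) (rho : T -> T -> R) (A : set T) :
    \bar R :=
  ereal_sup [set (rho a b)%:E | a in A & b in A].

(* m open rho-balls of radius eps with centers in C cover A. *)
Definition has_cover (R : realType) (T : Type) (C : set T)
    (rho : T -> T -> R) (A : set T) (eps : R) (m : nat) : Prop :=
  exists c : 'I_m -> T, (forall i, C (c i)) /\
    A `<=` \bigcup_(i in [set: 'I_m]) [set a | rho (c i) a < eps].

Definition totally_bounded (R : realType) (T : Type)
    (rho : T -> T -> R) (A : set T) : Prop :=
  forall eps : R, 0 < eps -> exists m, has_cover A rho A eps m.

(* The infimum is a minimum, and equals +oo iff there is no finite cover. *)
Definition covering_number (R : realType) (T : Type) (C : set T)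
    (A : set T) (rho : T -> T -> R) (eps : R) : \bar R :=
  ereal_inf [set (m%:R : R)%:E | m in [set m | has_cover C rho A eps m]].

Definition continuous_maps (X Y : topologicalType) : set (X -> Y) :=
  [set f | continuous f].

(* Integral over ]0, diam_S(F)], the covering centers ranging over C(X, X). *)
Definition entropy_integral (R : realType) (X : metricType R) (n : nat)
    (S : 'I_n -> X) (F : set (X -> X)) : \bar R :=
  (\int[lebesgue_measure]_(eps in [set eps : R |
       (0 < eps)%R /\ eps%:E <= diam (dS S) F])
     sqrte (lne (covering_number (@continuous_maps X X) F (dS S) eps)))%E.

(* Since +oo - +oo = -oo - -oo = -oo in \bar R, the case f = g makes this
   condition include that every Zsup S H f is real-valued, as is implicit in
   writing |Z_f - Z_g|. *)
Definition subgaussian_increments (R : realType) (X : metricType R) (n : nat)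
    (S : 'I_n -> X) (H : set (X -> R)) (F : set (X -> X)) (L A_H : R) : Prop :=
  forall f g, F f -> F g -> forall t : R, 0 < t ->
    Psigma R (fun s : signs n =>
        (t%:E < `| Zsup S H f s - Zsup S H g s |)%E) <=
      if dS S f g == 0 then 0
      else 2 * expR (- (n%:R * t ^+ 2 /
                        (2 * A_H ^+ 2 * L ^+ 2 * dS S f g ^+ 2))).

Definition entropy_bound (R : realType) (X : metricType R) (n : nat)
    (S : 'I_n -> X) (H : set (X -> R)) (F : set (X -> X)) (L A_H : R) : Prop :=
  (rademacher_complexity S (comp_class H F) <=
   rademacher_complexity S H +
     (12 * A_H * L / Num.sqrt n%:R)%:E * entropy_integral S F)%E.

(* Main.v *)
Require Import Defs.
From HB Require Import structures.
From mathcomp Require Import all_boot all_order all_algebra.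
From mathcomp Require Import all_classical all_reals all_analysis.
From mathcomp Require Import measurable_realfun ring lra.

(* Dudley's chaining with scales adapted to the entropy. The [j]-th scale is the
   infimum of the radii at which fewer than [2 ^ (level j ^ 2)] balls cover [F],
   so that below it the entropy integrand is at least [level j * sqrt (ln 2)],
   and the levels essentially double.  Covers have arbitrary centers, so nets
   inside [F] lose a factor 2 in the radius, and the tail bound carries another
   factor 2; chaining along the radii [D / 2 ^ j] would therefore miss the
   constant 12, whereas the adapted scales lose nothing when the sum of the
   increments is compared to the integral. *)

Set Implicit Arguments.
Unset Strict Implicit.
Unset Printing Implicit Defensive.

Import Order.TTheory GRing.Theory Num.Theory.
Import numFieldNormedType.Exports.

Local Open Scope classical_set_scope.
Local Open Scope ring_scope.

(** * Probability on the finite space of sign vectors *)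

Definition expectation_sigma (R : realType) (n : nat) (phi : signs n -> R) : R :=
  \sum_(s : signs n) rademacher_mass R s * phi s.

Lemma rademacher_massE (R : realType) (n : nat) (s : signs n) :
  rademacher_mass R s = 2 ^- n.
Proof. by rewrite /rademacher_mass prodr_const card_ord exprVn. Qed.

Lemma rademacher_mass_ge0 (R : realType) (n : nat) (s : signs n) :
  0 <= rademacher_mass R s.
Proof. by rewrite rademacher_massE invr_ge0 exprn_ge0. Qed.

Lemma sum_rademacher_mass (R : realType) (n : nat) :
  \sum_(s : signs n) rademacher_mass R s = 1.
Proof.
under eq_bigr do rewrite rademacher_massE.
rewrite sumr_const card_ffun card_bool card_ord -[LHS]mulr_natr natrX.
by rewrite mulVf// expf_neq0.
Qed.

Lemma EsigmaE (R : realType) (n : nat) (phi : signs n -> R) :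
  Esigma (EFin \o phi) = (expectation_sigma phi)%:E.
Proof. by rewrite /Esigma /expectation_sigma -sumEFin. Qed.

Lemma expectation_sigmaD (R : realType) (n : nat) (phi psi : signs n -> R) :
  expectation_sigma (fun s => phi s + psi s) =
  expectation_sigma phi + expectation_sigma psi.
Proof.
by rewrite /expectation_sigma -big_split; apply: eq_bigr => s _; rewrite mulrDr.
Qed.

Lemma expectation_sigma_cst (R : realType) (n : nat) (a : R) :
  expectation_sigma (fun _ : signs n => a) = a.
Proof. by rewrite /expectation_sigma -mulr_suml sum_rademacher_mass mul1r. Qed.

Lemma le_Esigma (R : realType) (n : nat) (phi psi : signs n -> \bar R) :
  (forall s, phi s <= psi s)%E -> (Esigma phi <= Esigma psi)%E.
Proof.
move=> le_phi; apply: lee_sum => s _; apply: lee_wpmul2l => //.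
by rewrite lee_fin rademacher_mass_ge0.
Qed.

Lemma le_Psigma (R : realType) (n : nat) (A B : pred (signs n)) :
  (forall s, A s -> B s) -> Psigma R A <= Psigma R B.
Proof.
move=> AB; rewrite /Psigma [leLHS]big_mkcond [leRHS]big_mkcond/=.
apply: ler_sum => s _; case: ifPn => [/AB -> //|_].
by case: ifP => // _; exact: rademacher_mass_ge0.
Qed.

Lemma Psigma_union_le (R : realType) (n m : nat) (A : 'I_m -> pred (signs n)) :
  Psigma R (fun s => [exists i, A i s]) <= \sum_(i < m) Psigma R (A i).
Proof.
rewrite /Psigma [leLHS]big_mkcond/=.
under [leRHS]eq_bigr do rewrite big_mkcond/=.
rewrite exchange_big/=; apply: ler_sum => s _.
case: ifPn => [/existsP[i Ais]|_].
  rewrite (bigD1 i)//= Ais lerDl; apply: sumr_ge0 => j _.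
  by case: ifP => // _; exact: rademacher_mass_ge0.
by apply: sumr_ge0 => j _; case: ifP => // _; exact: rademacher_mass_ge0.
Qed.

(** All atoms have the same positive mass, so a small enough tail bound becomes a bound valid at
    every sign vector. *)
Lemma Psigma_lt_mass (R : realType) (n : nat) (A : pred (signs n)) (s : signs n) :
  Psigma R A < 2 ^- n -> ~~ A s.
Proof.
rewrite -(rademacher_massE R s); apply: contraTN => As.
rewrite -leNgt /Psigma (bigD1 s)//= lerDl.
by apply: sumr_ge0 => *; exact: rademacher_mass_ge0.
Qed.

(** * Expectations from subgaussian tails *)

(** A discrete layer-cake formula: after averaging over the signs, it bounds an expectation by a
    finite sum of tail probabilities. *)
Lemma le_staircase (R : realType) (x tau eta : R) (K : nat) :
  0 <= eta -> x <= tau + K%:R * eta ->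
  x <= tau + eta * \sum_(i < K) (tau + i%:R * eta < x)%R%:R.
Proof.
move=> eta0; elim: K => [|K IH] xK.
  by move: xK; rewrite big_ord0 mul0r mulr0.
have [xleK|Kltx] := leP x (tau + K%:R * eta).
  apply: (le_trans (IH xleK)); rewrite big_ord_recr/= mulrDr lerD2l lerDl.
  exact: mulr_ge0.
rewrite (eq_bigr (fun=> 1)) ?sumr_const ?card_ord; last first.
  move=> i _; rewrite (le_lt_trans _ Kltx)// lerD2l ler_wpM2r// ler_nat.
  by rewrite -ltnS.
by rewrite mulrC.
Qed.

Lemma ln2_gt0 (R : realType) : 0 < ln 2 :> R.
Proof. by rewrite ln_gt0// ltr1n. Qed.

Lemma expR_ln2M (R : realType) (k : nat) : expR (- (ln 2 * k%:R)) = 2 ^- k :> R.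
Proof. by rewrite expRN mulrC expRM_natl lnK// posrE. Qed.

(* Cutting the tail at the levels [t_i = c sqrt(ln 2) (b + i / b)], where
   [b ^ 2 = 2 (k + 1)], makes the i-th tail probability at most [2 ^- i]. *)
Lemma expectation_le_of_subgaussian_tail (R : realType) (n : nat)
    (M : signs n -> R) (c : R) (k : nat) (b := Num.sqrt (2 * k.+1%:R)) :
  0 < c ->
  (forall t, 0 < t ->
     Psigma R (fun s => t < M s) <=
     2 ^+ k.+1 * expR (- (t ^+ 2 / (2 * c ^+ 2)))) ->
  expectation_sigma M <= c * Num.sqrt (ln 2) * (b + 2 / b).
Proof.
move=> c0 tailM; set l := Num.sqrt (ln 2).
have l0 : 0 < l by rewrite sqrtr_gt0 ln2_gt0.
have b0 : 0 < b by rewrite sqrtr_gt0 mulr_gt0.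
have b2 : b ^+ 2 = 2 * k.+1%:R by rewrite sqr_sqrtr.
have l2 : l ^+ 2 = ln 2 by rewrite sqr_sqrtr// ltW// ln2_gt0.
pose tau := c * l * b; pose eta := c * l / b.
have tau0 : 0 < tau by rewrite !mulr_gt0.
have eta0 : 0 < eta by rewrite !mulr_gt0// invr_gt0.
have -> : c * l * (b + 2 / b) = tau + eta * 2.
  by rewrite /tau /eta; ring.
(* [M] takes finitely many values, so finitely many steps of height [eta] reach above all of
   them. *)
have [K MK] : exists K : nat, forall s, M s <= tau + K%:R * eta.
  pose B := \big[Num.max/0]_s M s.
  exists (Num.bound (B / eta)) => s; apply: (@le_trans _ _ B).
    exact: le_bigmax.
  rewrite -[leLHS]add0r lerD ?(ltW tau0)// ltW// -ltr_pdivrMr//.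
  by rewrite archi_boundP// divr_ge0 ?(ltW eta0)//; exact: bigmax_ge_id.
have tailK (i : nat) : Psigma R (fun s => tau + i%:R * eta < M s) <= 2 ^- i.
  have t0 : 0 < tau + i%:R * eta by rewrite ltr_wpDr// mulr_ge0// ltW.
  apply: (le_trans (tailM _ t0)).
  (* In the expanded square the leading term cancels the prefactor [2 ^+ k.+1], the cross term
     yields [2 ^- i], and the last square is dropped. *)
  have le_exp : ln 2 * (k.+1 + i)%:R <=
      (tau + i%:R * eta) ^+ 2 / (2 * c ^+ 2).
    have -> : (tau + i%:R * eta) ^+ 2 / (2 * c ^+ 2) =
        l ^+ 2 * (b ^+ 2 / 2 + i%:R + (i%:R / b) ^+ 2 / 2).
      by rewrite /tau /eta; field; rewrite !gt_eqF.
    rewrite l2 ler_wpM2l ?(ltW (ln2_gt0 R))// b2 natrD.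
    have := sqr_ge0 (i%:R / b : R); lra.
  apply: (@le_trans _ _ (2 ^+ k.+1 * expR (- (ln 2 * (k.+1 + i)%:R)))).
    by rewrite ler_wpM2l ?exprn_ge0// ler_expR lerN2.
  by rewrite expR_ln2M exprD invfM mulrA divff ?mul1r// expf_neq0.
have step : expectation_sigma M <=
    tau + eta * \sum_(i < K) Psigma R (fun s => tau + i%:R * eta < M s).
  rewrite [X in _ <= X + _](_ : tau =
    \sum_(s : signs n) rademacher_mass R s * tau); last first.
    by rewrite -mulr_suml sum_rademacher_mass mul1r.
  rewrite /Psigma; under [X in _ + eta * X]eq_bigr do rewrite big_mkcond/=.
  rewrite exchange_big/= mulr_sumr -big_split/=; apply: ler_sum => s _.
  have -> : \sum_(i < K)
      (if tau + i%:R * eta < M s then rademacher_mass R s else 0) = rademacher_mass R s * \sum_(i < K) (tau + i%:R * eta < M s)%R%:R.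
    rewrite mulr_sumr; apply: eq_bigr => i _.
    by case: ifP; rewrite ?mulr1 ?mulr0.
  rewrite [X in _ + X]mulrCA -mulrDr ler_wpM2l ?rademacher_mass_ge0//.
  exact: le_staircase (ltW eta0) (MK s).
apply: (le_trans step); rewrite lerD2l ler_wpM2l ?(ltW eta0)//.
apply: (@le_trans _ _ (\sum_(i < K) 2 ^- i)).
  by apply: ler_sum => i _; exact: tailK.
(* The geometric sum stays below 2; multiplied by [eta] this is the source of the term [2 / b]. *)
have -> : \sum_(i < K) 2 ^- i = 2 - 2 * 2 ^- K :> R.
  elim: K {MK step} => [|K IH]; first by rewrite big_ord0 expr0; field.
  by rewrite big_ord_recr/= IH exprS; field; rewrite expf_neq0.
have : 0 <= 2 ^- K :> R by rewrite invr_ge0 exprn_ge0.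
lra.
Qed.

(** * Levels and their growth *)

(** The values are 1, 3, 6, 12, and so on. Pure doubling 1, 2, 4 would violate the bound of
    [level_gap_step] at [j = 1], where [b ^+ 2 = 34] and [b + 2 / b] exceeds 6. *)
Fixpoint level (j : nat) : nat := if j is j'.+1 then 3 * 2 ^ j' else 1.

Definition level_gap (R : realType) (j : nat) : R :=
  if j is j'.+1 then (level j)%:R - (level j')%:R else 1.

Lemma sum_level_gap (R : realType) (J : nat) :
  \sum_(j < J.+1) level_gap R j = (level J)%:R.
Proof.
elim: J => [|J IH]; first by rewrite big_ord1.
by rewrite big_ord_recr/= IH; ring.
Qed.

Lemma leq_level (j : nat) : (j <= level j)%N.
Proof.
case: j => [|j] //=; apply: (leq_trans (ltn_expl j (ltnSn 1))).
exact: leq_pmull.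
Qed.

Lemma ltn_exp_level (j : nat) : (j < 2 ^ (level j ^ 2))%N.
Proof.
apply: leq_trans (ltn_expl j (ltnSn 1)) _; rewrite leq_pexp2l//.
apply: leq_trans (leq_level j) _.
by case: j => // j; rewrite expnS expn1 leq_pmulr// muln_gt0 expn_gt0.
Qed.

Lemma level_gap_ge0 (R : realType) (j : nat) : 0 <= level_gap R j.
Proof.
case: j => [|[|j]] //=; first by rewrite subr_ge0 ler_nat.
by rewrite subr_ge0 ler_nat leq_pmul2l// leq_exp2l.
Qed.

(* The growth rate of [level] is chosen for this bound to hold: asymptotically
   it reads [sqrt 2 * 2 <= 6 * (1 - 1 / 2)]. *)
Lemma level_gap_step (R : realType) (j : nat)
    (b := Num.sqrt (2 * (level j.+1 ^ 2).+1%:R)) :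
  b + 2 / b <= 6 * level_gap R j.
Proof.
have b0 : 0 < b by rewrite sqrtr_gt0 mulr_gt0.
have b2 : b ^+ 2 = 2 * ((level j.+1)%:R ^+ 2 + 1).
  by rewrite sqr_sqrtr// -natrX natr1.
have g0 := level_gap_ge0 R j.
suff : (b ^+ 2 + 2) ^+ 2 <= 36 * level_gap R j ^+ 2 * b ^+ 2.
  move=> H; have : b ^+ 2 + 2 <= 6 * level_gap R j * b.
    rewrite -(ler_pXn2r (ltn0Sn 1)) ?nnegrE ?addr_ge0 ?sqr_ge0//; last first.
      by rewrite !mulr_ge0// ltW.
    by apply: (le_trans H); rewrite !exprMn; lra.
  by move=> {}H; rewrite -(ler_pM2r b0) (le_trans _ H)// mulrDl divfK ?gt_eqF.
(* The first two cases are numerical. Afterwards the gap is [u] and the level is [4 * u], which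
   leaves a quadratic inequality in [v = u ^+ 2], true for [v >= 9]. *)
rewrite {}b2; case: j {b b0 g0} => [|[|j]]; [rewrite /=; lra| rewrite /=; lra|].
set u : R := (3 * 2 ^ j)%:R.
have u3 : 3 <= u by rewrite /u ler_nat leq_pmulr// expn_gt0.
have -> : (level j.+3)%:R = 4 * u.
  by rewrite /u -natrM; congr _%:R; rewrite /= !expnS; ring.
have -> : level_gap R j.+2 = u.
  rewrite /level_gap [level j.+2]/= [level j.+1]/= /u expnS.
  by rewrite !natrM; ring.
have : 9 <= u ^+ 2 by rewrite expr2; nra.
move: (u ^+ 2) (exprMn 2 4 u) => v -> v9.
nra.
Qed.

(** * Entropy scales and a lower bound for the entropy integral *)

(** The squared exponent makes the root of the entropy linear in the level. The strict inequality
    lets its failure lose nothing in that root, and at level 0 it allows at most one ball. *)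
Definition few_balls (R : realType) (T : Type) (C : set T) (rho : T -> T -> R)
    (A : set T) (j : nat) (eps : R) : Prop :=
  exists2 m, (m < 2 ^ (level j ^ 2))%N & has_cover C rho A eps m.

Lemma few_ballsW (R : realType) (T : Type) (C : set T) (rho : T -> T -> R)
    (A : set T) (j : nat) (eps : R) :
  has_cover C rho A eps 1 -> few_balls C rho A j eps.
Proof.
exists 1%N => //.
apply: leq_trans (_ : 2 ^ 1 <= _)%N; rewrite // leq_exp2l// expn_gt0.
by case: j => // j; rewrite muln_gt0 expn_gt0.
Qed.

Definition scale (R : realType) (T : Type) (C : set T) (rho : T -> T -> R)
    (A : set T) (j : nat) : R :=
  inf [set eps : R | 0 < eps /\ few_balls C rho A j eps].

Lemma scale_ge0 (R : realType) (T : Type) (C : set T) (rho : T -> T -> R)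
    (A : set T) (j : nat) : 0 <= scale C rho A j.
Proof.
rewrite /scale; set E := [set _ | _].
have [->|/set0P ne] := eqVneq E set0; first by rewrite inf0.
by apply: lb_le_inf => // x [/ltW].
Qed.

Lemma scale_lbound (R : realType) (T : Type) (C : set T) (rho : T -> T -> R)
    (A : set T) (j : nat) (eps : R) :
  0 < eps -> few_balls C rho A j eps -> scale C rho A j <= eps.
Proof. by move=> e0 fb; apply: ge_inf => //; exists 0 => x [/ltW]. Qed.

(** The infimum may be 0 or not attained, whereas chaining needs positive radii that carry a cover;
    hence the slack [eta]. *)
Lemma scale_adherent (R : realType) (T : Type) (C : set T) (rho : T -> T -> R)
    (A : set T) (j : nat) (B eta : R) :
  0 < B -> few_balls C rho A j B -> 0 < eta ->
  exists r, [/\ 0 < r, few_balls C rho A j r & r <= scale C rho A j + eta].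
Proof.
move=> B0 fbB eta0.
have hinf : has_inf [set eps : R | 0 < eps /\ few_balls C rho A j eps].
  by split; [exists B|exists 0 => x [/ltW]].
have [r [r0 fbr] rlt] := inf_adherent eta0 hinf.
by exists r; split => //; exact: ltW.
Qed.

Lemma sqrt_entropy_ge (R : realType) (T : Type) (C : set T) (rho : T -> T -> R)
    (A : set T) (j : nat) (eps : R) :
  ~ few_balls C rho A j eps ->
  (((level j)%:R * Num.sqrt (ln 2))%:E <=
   sqrte (lne (covering_number C A rho eps)))%E.
Proof.
move=> nfb.
have le_cov : ((2 ^+ (level j ^ 2))%:E <= covering_number C A rho eps)%E.
  apply: le_ereal_inf_tmp => _ [m cov_m <-]; rewrite lee_fin -natrX ler_nat.
  by rewrite leqNgt; apply/negP => lt_m; apply: nfb; exists m.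
have pow0 : 0 < 2 ^+ (level j ^ 2) :> R by rewrite exprn_gt0.
have -> : (level j)%:R * Num.sqrt (ln 2) =
    Num.sqrt (ln (2 ^+ (level j ^ 2))) :> R.
  rewrite lnXn// -[ln 2 *+ _]mulr_natl natrX sqrtrM ?sqr_ge0//.
  by rewrite sqrtr_sqr ger0_norm.
have -> : (Num.sqrt (ln (2 ^+ (level j ^ 2))))%:E =
    sqrte (lne (2 ^+ (level j ^ 2))%:E) :> \bar R by rewrite lne_EFin.
rewrite lee_sqrt; last first.
  by rewrite lne_ge0 (le_trans _ le_cov)// lee_fin exprn_ege1// ler1n.
rewrite lee_lne// in_itv/= leey andbT ?lee_fin ?(ltW pow0)//.
by rewrite (le_trans _ le_cov)// lee_fin ltW.
Qed.

(** Every simple function below [f] is below [g], so the definition of the integral as a supremum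
    gives monotonicity for arbitrary nonnegative functions. It is applied to the entropy integrand,
    whose measurability is never established. *)
Lemma ge0_le_integralT d (T : measurableType d) (R : realType)
    (mu : {measure set T -> \bar R}) (f g : T -> \bar R) :
  (forall x, 0 <= f x)%E -> (forall x, f x <= g x)%E ->
  (\int[mu]_x f x <= \int[mu]_x g x)%E.
Proof.
move=> f0 fg; rewrite !ge0_integralTE//; last first.
  by move=> x; exact: le_trans (f0 x) (fg x).
apply: ereal_sup_le => _ [h hf <-].
by exists h => // x; exact: le_trans (hf x) (fg x).
Qed.

(** Were the diameter smaller than [eps], one ball around [o] would cover [F]. Hence the positive
    radii below a scale lie in the domain of the entropy integral. *)
Lemma diam_ge_of_not_few_balls (R : realType) (T : Type) (C : set T)
    (rho : T -> T -> R) (F : set T) (o : T) (j : nat) (eps : R) :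
  C o -> F o -> ~ few_balls C rho F j eps -> (eps%:E <= diam rho F)%E.
Proof.
move=> Co Fo; rewrite leNgt => nfb; apply/negP => diam_lt; apply: nfb.
apply: few_ballsW.
exists (fun=> o); split => // f Ff; exists ord0 => //=.
rewrite -lte_fin (le_lt_trans _ diam_lt)//.
by apply: ereal_sup_ubound; exists o => //; exists f.
Qed.

(** The sum is the integral of stacked layers, the [j]-th having height
    [level_gap R j * Num.sqrt (ln 2)] over the radii below the [j]-th scale; the stack lies under
    the entropy integrand. *)
Lemma entropy_integral_ge (R : realType) (T : Type) (C : set T)
    (rho : T -> T -> R) (F : set T) (o : T) (J : nat) :
  C o -> F o ->
  ((\sum_(j < J) level_gap R j * Num.sqrt (ln 2) * scale C rho F j)%:E <=
   \int[lebesgue_measure]_(eps in [set eps : R |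
       (0 < eps)%R /\ eps%:E <= diam rho F])
     sqrte (lne (covering_number C F rho eps)))%E.
Proof.
move=> Co Fo; set D := [set _ | _].
pose I j : set R := `]0, scale C rho F j[%classic.
have mI j : measurable (I j) by exact: measurable_itv.
have leb j : lebesgue_measure (I j) = (scale C rho F j)%:E.
  rewrite /I lebesgue_measure_itv/= lte_fin.
  case: ltP => [_|le0]; first by rewrite sube0.
  by have /eqP -> : scale C rho F j == 0 by rewrite eq_le le0 scale_ge0.
pose c j := level_gap R j * Num.sqrt (ln 2).
have c0 j : 0 <= c j by rewrite mulr_ge0// level_gap_ge0.
have -> : (\sum_(j < J) c j * scale C rho F j)%:E =
    (\int[lebesgue_measure]_x \sum_(j < J) (c j)%:E * (\1_(I j) x)%:E)%E.
  rewrite ge0_integral_sum//; last 2 first.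
  - move=> j; apply: measurable_funeM; apply/measurable_EFinP.
    exact: measurable_indic (mI j).
  - by move=> j x _; rewrite mule_ge0 ?lee_fin.
  rewrite -sumEFin; apply: eq_bigr => j _.
  rewrite ge0_integralZl_EFin//; last first.
    by apply/measurable_EFinP; exact: measurable_indic (mI j).
  rewrite integral_indic; [|exact: measurableT|exact: mI].
  by rewrite setIT EFinM -leb.
rewrite [leRHS]integral_mkcond; apply: ge0_le_integralT => [x|x].
  by apply: sume_ge0 => j _; rewrite mule_ge0 ?lee_fin.
elim: J => [|J IH].
  by rewrite big_ord0; apply: erestrict_ge0 => y _; exact: sqrte_ge0.
(* The last layer containing [x] decides: it bounds the integrand below by its level, and with all
   earlier indicators replaced by 1 the gaps telescope to that same level. *)
have [xI|xI] := pselect (I J x); last first.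
  by rewrite big_ord_recr/= indicE memNset// mule0 adde0.
have /andP[x0 xlt] : 0 < x < scale C rho F J by move: xI; rewrite /I/= in_itv.
have nfb : ~ few_balls C rho F J x.
  by move=> fb; have := lt_le_trans xlt (scale_lbound x0 fb); rewrite ltxx.
have Dx : D x.
  by split => //; exact: (diam_ge_of_not_few_balls Co Fo nfb).
rewrite patchE mem_set//; apply: le_trans (sqrt_entropy_ge nfb).
rewrite -sum_level_gap mulr_suml -sumEFin; apply: lee_sum => j _.
by rewrite -EFinM lee_fin ler_piMr// indicE lern1 leq_b1.
Qed.

(** * Nets and chaining *)

(** Moves the centers into [F], where increments are controlled: a ball meeting [F] receives one of
    its points in [F], any other ball receives [o]. Two points of one ball are less than [2 * r]
    apart, whence the doubled radius. *)
Lemma few_balls_net (R : realType) (T : Type) (C : set T) (rho : T -> T -> R)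
    (F : set T) (o : T) (j : nat) (r : R) :
  (forall f c g, rho c f < r -> rho c g < r -> rho f g < 2 * r) ->
  F o -> few_balls C rho F j r ->
  exists m (p : 'I_m -> T), [/\ (m < 2 ^ (level j ^ 2))%N, forall i, F (p i) &
    forall f, F f -> exists i, rho f (p i) < 2 * r].
Proof.
move=> tri Fo [m m_lt [c [_ cover]]].
have /choice[p pP] : forall i : 'I_m, exists q, F q /\
    forall f, F f -> rho (c i) f < r -> rho (c i) q < r.
  move=> i.
  have [[q [Fq cq]]|none] := pselect (exists q, F q /\ rho (c i) q < r).
    by exists q.
  by exists o; split => // f Ff cf; case: none; exists f.
exists m, p; split => // [i|f Ff]; first by have [] := pP i.
have [i _ /= cf] := cover f Ff; exists i; apply: (tri _ (c i)) => //.
exact: (pP i).2 cf.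
Qed.

(** Stating the tail through a positive [delta] above the distance absorbs the degenerate case of
    distance 0. *)
Definition subgaussian_field (R : realType) (n : nat) (T : Type)
    (rho : T -> T -> R) (F : set T) (z : T -> signs n -> R) (kappa : R) : Prop :=
  forall f g delta t, F f -> F g -> 0 < delta -> rho f g <= delta -> 0 < t ->
    Psigma R (fun s => t < `|z f s - z g s|) <=
    2 * expR (- (t ^+ 2 / (2 * (kappa * delta) ^+ 2))).

(* Every atom has mass [2 ^- n], so tails below this level vanish. *)
Lemma subgaussian_field_lipschitz (R : realType) (n : nat) (T : Type)
    (rho : T -> T -> R) (F : set T) (z : T -> signs n -> R) (kappa : R)
    (f g : T) (delta : R) (s : signs n) :
  0 < kappa -> subgaussian_field rho F z kappa -> F f -> F g -> 0 < delta ->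
  rho f g <= delta ->
  `|z f s - z g s| <= kappa * Num.sqrt (2 * (ln 2 * n.+2%:R)) * delta.
Proof.
(* With this [b] the tail bound is [2 * 2 ^- n.+2], half the mass of an atom. *)
move=> kappa0 sub Ff Fg delta0 fg; set b := Num.sqrt _.
have l0 : 0 < ln 2 * n.+2%:R :> R by rewrite mulr_gt0 ?ln2_gt0.
have b0 : 0 < b by rewrite sqrtr_gt0 mulr_gt0.
have b2 : b ^+ 2 = 2 * (ln 2 * n.+2%:R) by rewrite sqr_sqrtr// mulr_ge0// ltW.
have t0 : 0 < kappa * b * delta by rewrite !mulr_gt0.
rewrite leNgt; apply: (Psigma_lt_mass (R := R)
  (A := fun s => kappa * b * delta < `|z f s - z g s|)).
apply: (le_lt_trans (sub _ _ _ _ Ff Fg delta0 fg t0)).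
have -> : (kappa * b * delta) ^+ 2 / (2 * (kappa * delta) ^+ 2) = b ^+ 2 / 2.
  by field; rewrite !gt_eqF.
rewrite b2 [X in X / 2]mulrC mulfK// expR_ln2M.
rewrite !exprS; have : 0 < 2 ^- n :> R by rewrite invr_gt0 exprn_gt0.
have n0 : 2 ^+ n != 0 :> R by rewrite expf_neq0.
have -> : 2 * (2 * (2 * 2 ^+ n))^-1 = 2^-1 * 2 ^- n :> R by field.
lra.
Qed.

(* The chain is a tree: the parent of a point of the net of level [j + 1] is a
   function of that point alone, so that only as many increments occur as the
   finer net has points. *)
Lemma chaining (R : realType) (n : nat) (T : Type) (C : set T)
    (rho : T -> T -> R) (F : set T) (o : T) (z : T -> signs n -> R) (kappa : R)
    (r : nat -> R) (J : nat) :
  (forall f c g x, rho c f < x -> rho c g < x -> rho f g < 2 * x) ->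
  F o -> 0 < kappa -> subgaussian_field rho F z kappa ->
  (forall j, 0 < r j) -> (forall j, few_balls C rho F j (r j)) ->
  exists m (p : 'I_m -> T) (W : signs n -> R),
    [/\ forall i, F (p i), forall f, F f -> exists i, rho f (p i) < 2 * r J,
        forall i s, z (p i) s <= z o s + W s &
        expectation_sigma W <=
          12 * kappa * \sum_(j < J) level_gap R j * Num.sqrt (ln 2) * r j].
Proof.
move=> tri Fo kappa0 sub r0 few; elim: J => [|J [m [p [W [Fp cover zW EW]]]]].
  (* Level 0 allows at most one ball and [F] contains [o], so a single ball covers [F] and [o] alone
     is a net. *)
  exists 1%N, (fun=> o), (fun=> 0); split => //.
  - move=> f Ff; exists ord0.
    have [[|[|m]] // _ [c [_ cover]]] := few 0%N.
      by have [[]] := cover o Fo.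
    have [i _ /= cf] := cover f Ff; have [i' _ /= co] := cover o Fo.
    by apply: (tri _ (c i)) => //; rewrite (ord1 i) -(ord1 i').
  - by move=> _ s; rewrite addr0.
  - by rewrite expectation_sigma_cst big_ord0 mulr0.
have [m' [q [m'_lt Fq cover']]] :=
  few_balls_net (fun f c g => tri f c g (r J.+1)) Fo (few J.+1).
have /choice[a aP] : forall i : 'I_m', exists i', rho (q i) (p i') < 2 * r J.
  by move=> i; exact: cover.
pose Y i s := `|z (q i) s - z (p (a i)) s|.
pose M s := \big[Num.max/0]_(i < m') Y i s.
exists m', q, (fun s => W s + M s); split => //.
  move=> i s; have : Y i s <= M s by exact: (le_bigmax 0 (Y^~ s) i).
  have := ler_norm (z (q i) s - z (p (a i)) s); have := zW (a i) s.
  rewrite /Y; lra.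
rewrite expectation_sigmaD big_ord_recr/= [leRHS]mulrDr lerD//.
have c0 : 0 < kappa * (2 * r J) by rewrite !mulr_gt0.
(* Fewer than [2 ^ k] increments occur, with [k = level J.+1 ^ 2], and the two-sided tail
   contributes one more factor 2. Each increment spans less than [2 * r J], the coarser net
   distance. *)
apply: (le_trans (expectation_le_of_subgaussian_tail (M := M)
  (k := (level J.+1 ^ 2)%N) c0 _)) => [t t0|].
  apply: (@le_trans _ _ (Psigma R (fun s => [exists i, t < Y i s]))).
    apply: le_Psigma => s /bigmax_gtP[|[i _ tY]]; first by rewrite ltNge ltW.
    by apply/existsP; exists i.
  apply: le_trans (Psigma_union_le _ _) _.
  set e := expR _; apply: (@le_trans _ _ (\sum_(i < m') 2 * e)).
    by apply: ler_sum => i _; apply: sub => //; [rewrite mulr_gt0|exact: ltW].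
  rewrite sumr_const card_ord -[leLHS]mulr_natl mulrA ler_wpM2r ?expR_ge0//.
  by rewrite exprSr ler_wpM2r// -natrX ler_nat ltnW.
(* The constant 12 is the 2 from the net distance times the 6 from [level_gap_step]. *)
apply: le_trans (ler_wpM2l _ (level_gap_step R J)) _.
  by rewrite mulr_ge0// ltW.
by rewrite le_eqVlt; apply/orP; left; apply/eqP; ring.
Qed.

(** Provides one radius admissible at every level, so that each scale is the infimum of a nonempty
    set. [B] exceeds the distance from [o] to every center of a cover by unit balls. *)
Lemma totally_bounded_one_ball (R : realType) (T : Type) (C : set T)
    (rho : T -> T -> R) (F : set T) (o : T) :
  (forall f c g x, rho c f < x -> rho c g < x -> rho f g < 2 * x) ->
  C o -> F o -> totally_bounded rho F ->
  exists2 B, 0 < B & has_cover C rho F B 1.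
Proof.
move=> tri Co Fo /(_ 1 ltr01) [m [c [_ cover]]].
pose B := 1 + \sum_(i < m) `|rho (c i) o|.
have S0 (P : pred 'I_m) : 0 <= \sum_(i < m | P i) `|rho (c i) o|.
  by apply: sumr_ge0 => i _; exact: normr_ge0.
have B1 : 1 <= B by rewrite lerDl.
exists (2 * B); first by rewrite mulr_gt0// (lt_le_trans _ B1).
exists (fun=> o); split => // f Ff; exists ord0 => //=.
have [i _ /= cf] := cover f Ff; apply: (tri _ (c i)).
  rewrite /B (bigD1 i)//=; have := ler_norm (rho (c i) o).
  have := S0 (fun j => j != i); lra.
exact: lt_le_trans B1.
Qed.

(** Chaining stops at a finite stage; the remainder is bounded at every sign vector by the Lipschitz
    estimate at the last radius, and [eps] absorbs it. The common majorant [W] stands in for the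
    supremum over [F]. *)
Lemma expectation_sup_le_entropy (R : realType) (n : nat) (T : Type) (C : set T)
    (rho : T -> T -> R) (F : set T) (o : T) (z : T -> signs n -> R) (kappa : R) :
  (forall f c g x, rho c f < x -> rho c g < x -> rho f g < 2 * x) ->
  F `<=` C -> F o -> 0 < kappa -> subgaussian_field rho F z kappa ->
  totally_bounded rho F ->
  forall eps, 0 < eps -> exists2 W : signs n -> R,
    (forall f s, F f -> z f s <= z o s + W s) &
    ((expectation_sigma W)%:E <=
     (12 * kappa)%:E * (\int[lebesgue_measure]_(x in [set x : R |
         (0 < x)%R /\ x%:E <= diam rho F])
       sqrte (lne (covering_number C F rho x))) + eps%:E)%E.
Proof.
move=> tri FC Fo kappa0 sub tb eps eps0.
have [B B0 coverB] := totally_bounded_one_ball tri (FC _ Fo) Fo tb.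
have fewB j : few_balls C rho F j B by exact: few_ballsW.
pose K := 2 * (kappa * Num.sqrt (2 * (ln 2 * n.+2%:R))).
have K0 : 0 < K by rewrite !mulr_gt0// sqrtr_gt0 !mulr_gt0// ln2_gt0.
have [J scaleJ] : exists J, scale C rho F J <= eps / (2 * K).
  have e0 : 0 < eps / (2 * K) by rewrite divr_gt0// mulr_gt0.
  have [J [c [Fc cover]]] := tb _ e0.
  (* The number [J] of balls in an arbitrary cover also serves as the level, since
     [J < 2 ^ (level J ^ 2)]. *)
  exists J; apply: scale_lbound => //; exists J; first exact: ltn_exp_level.
  by exists c; split => // i; exact: FC.
pose G := \sum_(j < J) level_gap R j * Num.sqrt (ln 2).
have G0 : 0 <= G.
  by apply: sumr_ge0 => j _; rewrite mulr_ge0// level_gap_ge0.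
(* [N] collects every coefficient of the slack [eta], in the chaining sum and in the remainder, so
   the slack costs [eps / 2]; the other half pays for [K] times the last scale. As [G] depends on
   [J], [eta] comes after [J]. *)
pose N := 12 * kappa * G + K.
have N0 : 0 < N by rewrite ltr_wpDl// !mulr_ge0// ltW.
pose eta := eps / (2 * N).
have eta0 : 0 < eta by rewrite divr_gt0// mulr_gt0.
have /choice[r rP] := fun j => scale_adherent B0 (fewB j) eta0.
have r0 j : 0 < r j by have [] := rP j.
have fewr j : few_balls C rho F j (r j) by have [] := rP j.
have rle j : r j <= scale C rho F j + eta by have [] := rP j.
have [m [p [W [Fp cover zW EW]]]] := chaining J tri Fo kappa0 sub r0 fewr.
exists (fun s => W s + K * r J).
  move=> f s Ff; have [i fp] := cover f Ff.
  have := subgaussian_field_lipschitz s kappa0 sub Ff (Fp i)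
    (mulr_gt0 (ltr0Sn _ 1) (r0 J)) (ltW fp).
  rewrite mulrCA -mulrA -/K => lip; have := zW i s.
  have := ler_norm (z f s - z (p i) s); move: lip; rewrite /K; lra.
rewrite expectation_sigmaD expectation_sigma_cst.
have Kr : K * r J <= eps / 2 + K * eta.
  apply: (@le_trans _ _ (K * (eps / (2 * K) + eta))).
    by rewrite ler_wpM2l ?(ltW K0)// (le_trans (rle J))// lerD2r.
  rewrite mulrDr lerD2r le_eqVlt; apply/orP; left; apply/eqP.
  by field; rewrite gt_eqF.
pose E := \sum_(j < J) level_gap R j * Num.sqrt (ln 2) * scale C rho F j.
have sumr : \sum_(j < J) level_gap R j * Num.sqrt (ln 2) * r j <= E + G * eta.
  rewrite /E /G mulr_suml -big_split/=; apply: ler_sum => j _.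
  by rewrite -mulrDr ler_wpM2l// mulr_ge0// level_gap_ge0.
have total : expectation_sigma W + K * r J <= 12 * kappa * E + eps.
  have k0 : 0 <= 12 * kappa by rewrite mulr_ge0// ltW.
  have := ler_wpM2l k0 sumr.
  have : N * eta = eps / 2 by rewrite /eta; field; rewrite gt_eqF.
  move: Kr EW; rewrite /N; lra.
apply: (@le_trans _ _ ((12 * kappa)%:E * E%:E + eps%:E)%E).
  by rewrite -EFinM -EFinD lee_fin.
apply: leeD => //; apply: lee_wpmul2l.
  by rewrite lee_fin mulr_ge0// ltW.
exact: entropy_integral_ge (FC _ Fo) Fo.
Qed.

(** * The empirical pseudo-metric and the Rademacher bound *)

Lemma sqr_dS (R : realType) (X : metricType R) (n : nat) (S : 'I_n -> X)
    (f g : X -> X) :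
  dS S f g ^+ 2 = n%:R^-1 * \sum_(i < n) mdist (f (S i)) (g (S i)) ^+ 2.
Proof.
rewrite sqr_sqrtr// mulr_ge0// ?invr_ge0//.
by apply: sumr_ge0 => i _; exact: sqr_ge0.
Qed.

(** The pointwise bound [(b + d) ^+ 2 <= 2 * b ^+ 2 + 2 * d ^+ 2] takes the place of Minkowski's
    inequality, at no loss because both distances are compared with the same [x]. *)
Lemma dS_lt2 (R : realType) (X : metricType R) (n : nat) (S : 'I_n -> X)
    (f c g : X -> X) (x : R) :
  dS S c f < x -> dS S c g < x -> dS S f g < 2 * x.
Proof.
have d0 h k : 0 <= dS S h k by exact: sqrtr_ge0.
move=> cf cg; have x0 : 0 < x by exact: le_lt_trans cf.
have sq h k y : 0 < y -> (dS S h k < y) = (dS S h k ^+ 2 < y ^+ 2).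
  by move=> y0; rewrite ltr_pXn2r ?nnegrE ?d0 ?(ltW y0).
move: cf cg; rewrite !sq ?mulr_gt0// => cf cg.
suff : dS S f g ^+ 2 <= 2 * dS S c f ^+ 2 + 2 * dS S c g ^+ 2.
  by rewrite exprMn; lra.
rewrite !sqr_dS !(mulrCA 2) -mulrDr ler_wpM2l ?invr_ge0//.
rewrite !mulr_sumr -big_split/=; apply: ler_sum => i _.
have := metric_triangle (f (S i)) (c (S i)) (g (S i)).
rewrite (metric_sym (f (S i)) (c (S i))).
set a := mdist (f _) _; set b := mdist _ (f _); set d := mdist _ _ => abd.
have a0 : 0 <= a by exact: mdist_ge0.
have := sqr_ge0 (b - d); have : a ^+ 2 <= (b + d) ^+ 2.
  by rewrite ler_pXn2r ?nnegrE//; exact: le_trans a0 abd.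
rewrite !expr2; lra.
Qed.

Lemma entropy_bound_of_subgaussian (R : realType) (X : metricType R) (n : nat)
    (S : 'I_n -> X) (H : set (X -> R)) (F : set (X -> X)) (L A_H : R) :
  (0 < n)%N -> F `<=` @continuous_maps X X -> totally_bounded (dS S) F ->
  F idfun -> 0 < L -> 0 < A_H -> subgaussian_increments S H F L A_H ->
  entropy_bound S H F L A_H.
Proof.
move=> n0 Fcont tb Fid L0 A0 sub.
(* For [f = g] the assumed tail bound is 0, while an infinite value at [s] would make the difference
   infinite in absolute value and give the event at least the mass of the atom [s]. *)
have Zfin f s : F f -> Zsup S H f s \is a fin_num.
  move=> Ff; apply: contraPT (sub f f Ff Ff 1 ltr01) => Zinf; apply/negP.
  rewrite -ltNge; have -> : dS S f f == 0.
    rewrite /dS big1 ?mulr0 ?sqrtr0// => i _.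
    by rewrite mdistxx expr0n.
  have Zoo : (1%:E < `|Zsup S H f s - Zsup S H f s|)%E.
    by move: Zinf; case: (Zsup S H f s) => //= _; rewrite ltry.
  rewrite /Psigma (bigD1 s)//= ltr_pwDl//.
    by rewrite rademacher_massE invr_gt0 exprn_gt0.
  by apply: sumr_ge0 => *; exact: rademacher_mass_ge0.
pose z f s := fine (Zsup S H f s).
have ZE f s : F f -> Zsup S H f s = (z f s)%:E.
  by move=> Ff; rewrite fineK// Zfin.
pose kappa := A_H * L / Num.sqrt n%:R.
have sn0 : 0 < Num.sqrt n%:R :> R by rewrite sqrtr_gt0 ltr0n.
have kappa0 : 0 < kappa by rewrite divr_gt0// mulr_gt0.
have subz : subgaussian_field (dS S) F z kappa.
  move=> f g delta t Ff Fg delta0 fg t0.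
  have -> : Psigma R (fun s => t < `|z f s - z g s|) =
      Psigma R (fun s => (t%:E < `|Zsup S H f s - Zsup S H g s|)%E).
    by apply: eq_bigl => s; rewrite !ZE.
  apply: (le_trans (sub f g Ff Fg t t0)).
  case: ifPn => [_|d0]; first by rewrite mulr_ge0// expR_ge0.
  have {}d0 : 0 < dS S f g by rewrite lt_def d0 sqrtr_ge0.
  rewrite ler_wpM2l// ler_expR lerN2.
  have -> : n%:R * t ^+ 2 / (2 * A_H ^+ 2 * L ^+ 2 * dS S f g ^+ 2) =
      t ^+ 2 / (2 * (kappa * dS S f g) ^+ 2).
    have -> : (n%:R : R) = Num.sqrt n%:R ^+ 2 by rewrite sqr_sqrtr.
    by rewrite /kappa; field; rewrite !gt_eqF.
  have kd0 : 0 < kappa * dS S f g by rewrite mulr_gt0.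
  have kle : kappa * dS S f g <= kappa * delta.
    by rewrite ler_wpM2l// (ltW kappa0).
  have kdelta0 := lt_le_trans kd0 kle.
  have pos (y : R) : 0 < y -> 2 * y ^+ 2 \is Num.pos.
    by move=> y0; rewrite posrE mulr_gt0// exprn_gt0.
  rewrite ler_wpM2l ?sqr_ge0// lef_pV2 ?pos//.
  by rewrite ler_pM2l// ler_pXn2r ?nnegrE ?(ltW kd0) ?(ltW kdelta0).
have tri : forall f c g x,
    dS S c f < x -> dS S c g < x -> dS S f g < 2 * x by exact: dS_lt2.
rewrite /entropy_bound; apply/lee_addgt0Pr => eps eps0.
have [W zW EW] :=
  expectation_sup_le_entropy tri Fcont Fid kappa0 subz tb eps0.
have -> : 12 * A_H * L / Num.sqrt n%:R = 12 * kappa by rewrite /kappa; ring.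
(* The identity is the root of the chain: composing with it leaves [H] unchanged, so the root term
   is exactly the complexity of [H]. *)
have EH : rademacher_complexity S H = (expectation_sigma (z idfun))%:E.
  rewrite -EsigmaE; congr Esigma; apply/funext => s /=.
  by rewrite -ZE.
rewrite EH -addeA; apply: (le_trans _ (leeD2l _ EW)).
rewrite -EFinD -expectation_sigmaD -EsigmaE; apply: le_Esigma => s /=.
apply: ge_ereal_sup => _ [_ [h Hh [f Ff <-]] <-].
apply: (@le_trans _ _ (Zsup S H f s)).
  by apply: ereal_sup_ubound; exists h.
by rewrite ZE// lee_fin zW.
Qed.

Theorem theorem2 (R : realType) (X : metricType R) (n : nat) (n_gt0 : (0 < n)%N)
    (S : 'I_n -> X) (H : set (X -> R))
    (H_cont : H `<=` @continuous_maps X R) :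
  (forall F : set (X -> X),
     F `<=` @continuous_maps X X ->
     totally_bounded (dS S) F ->
     F idfun ->
     forall L A_H : R, 0 < L -> 0 < A_H ->
     subgaussian_increments S H F L A_H ->
     entropy_bound S H F L A_H) /\
  (forall (F0 : set (X -> X)) (k : nat),
     F0 `<=` @continuous_maps X X ->
     totally_bounded (dS S) (comp_ball k F0) ->
     forall L A_H : R, 0 < L -> 0 < A_H ->
     subgaussian_increments S H (comp_ball k F0) L A_H ->
     entropy_bound S H (comp_ball k F0) L A_H).
Proof.
split=> [F Fcont tb Fid L A_H L0 A0|F0 k F0cont tb L A_H L0 A0].
  exact: entropy_bound_of_subgaussian.
apply: entropy_bound_of_subgaussian => //; last by exists 0%N.
move=> f [m _]; elim: m f => [|m IH] f /=; first by move=> -> x; exact: cvg_id.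
move=> [h F0h [w /IH w_cont <-]] x.
exact: continuous_comp (w_cont x) (F0cont _ F0h _).
Qed.
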